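(* Let $(\mathcal{M}, d_{\mathrm{GH}})$ be the Gromov-Hausdorff space. For a real number $r>0$ put \[ \mathcal{M}_{\leq r}=\{Z\in\mathcal{M} \mid \operatorname{diam}(Z)\leq r\},\qquad \mathcal{B}(r)=\{Z\in\mathcal{M} \mid \operatorname{diam}(Z)=r\}, \] regarded as metric subspaces of $\mathcal{M}$. Then for every real $r>0$ and every positive integer $n$, the $n$-th cartesian power $(\mathcal{M}_{\leq r})^n$ equipped with the $\ell^\infty$ distance can be isometrically embedded into $\mathcal{B}(5rn)$; namely, there exists a map $\mathfrak{S}_{r,n}:(\mathcal{M}_{\leq r})^n\to\mathcal{B}(5rn)$ satisfying \[ d_{\mathrm{GH}}(\mathfrak{S}_{r,n}(X),\mathfrak{S}_{r,n}(Y))=\max_{k=1,2,\ldots,n}d_{\mathrm{GH}}(X_k,Y_k) \] for all $X=(X_k)_{k=1}^n,\ Y=(Y_k)_{k=1}^n\in(\mathcal{M}_{\leq r})^n$.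
   Context: The Gromov-Hausdorff space is the metric space $(\mathcal{M},d_{\mathrm{GH}})$, where $\mathcal{M}$ is a set of representatives of the isometry classes of nonempty compact metric spaces: every element of $\mathcal{M}$ is a nonempty compact metric space, every nonempty compact metric space is isometric to some element of $\mathcal{M}$, and two isometric elements of $\mathcal{M}$ are equal. For sets $X,Y$, let $\mathrm{GHC}(X,Y)$ be the collection of all subsets $R\subset X\times Y$ such that every $x\in X$ satisfies $(x,y)\in R$ for some $y\in Y$ and every $y\in Y$ satisfies $(x,y)\in R$ for some $x\in X$. For metric spaces $(X,d_X),(Y,d_Y)$ and $R\in\mathrm{GHC}(X,Y)$, the distortion is $\operatorname{dis}(R)=\sup\{|d_X(x,\xi)-d_Y(y,\eta)| \mid (x,y),(\xi,\eta)\in R\}$. The Gromov-Hausdorff distance is $d_{\mathrm{GH}}(X,Y)=\frac12\inf_{R\in\mathrm{GHC}(X,Y)}\operatorname{dis}(R)$. The diameter of a metric space $(X,d)$ is $\operatorname{diam}(X)=\sup_{x_0,x_1\in X}d(x_0,x_1)$. The $\ell^\infty$ distance on a finite product of metric spaces is the maximum of the coordinatewise distances. An isometric embedding is a distance-preserving map (not necessarily surjective). *)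

(* Defs.v *)
From mathcomp Require Import all_boot all_order all_algebra.
From mathcomp Require Import boolp classical_sets reals topology.

Set Implicit Arguments.
Unset Strict Implicit.
Unset Printing Implicit Defensive.

Import Order.TTheory GRing.Theory Num.Theory.
Local Open Scope classical_set_scope.
Local Open Scope ring_scope.

Definition nonempty_compact (R : realType) (X : metricType R) : Prop :=
  [set: X] !=set0 /\ compact [set: X].

Definition isometric (R : realType) (X Y : metricType R) : Prop :=
  exists f : X -> Y, bijective f /\ forall x y, mdist (f x) (f y) = mdist x y.

(* For nonempty compact spaces, all the real-valued [sup] and [inf] below are
   taken over nonempty bounded sets, so that the default value of [sup] and
   [inf] on other sets is irrelevant. *)

Definition diam (R : realType) (X : metricType R) : R :=
  sup [set mdist p.1 p.2 | p in [set: X * X]].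

Definition GHC (X Y : Type) : set (set (X * Y)) :=
  [set C | (forall x, exists y, C (x, y)) /\ (forall y, exists x, C (x, y))].

Definition distortion (R : realType) (X Y : metricType R) (C : set (X * Y)) : R :=
  sup [set `|mdist p.1 q.1 - mdist p.2 q.2| | p in C & q in C].

Definition dGH (R : realType) (X Y : metricType R) : R :=
  2^-1 * inf [set distortion C | C in @GHC X Y].

(* [M] is a set of representatives of the isometry classes of nonempty compact
   metric spaces, that is, the underlying set of the Gromov-Hausdorff space. It is a
   [metricType R -> Prop] and not a [set (metricType R)] because the latter is
   universe inconsistent. *)
Definition is_GH_space (R : realType) (M : metricType R -> Prop) : Prop :=
  [/\ forall X, M X -> nonempty_compact X,
      forall X : metricType R, nonempty_compact X ->
        exists2 Y : metricType R, M Y & isometric X Y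
    & forall X Y, M X -> M Y -> isometric X Y -> X = Y].

Definition GH_le (R : realType) (M : metricType R -> Prop) (r : R) : Type :=
  {Z : metricType R | M Z /\ diam Z <= r}.

Definition GH_sphere (R : realType) (M : metricType R -> Prop) (r : R) : Type :=
  {Z : metricType R | M Z /\ diam Z = r}.

Lemma isometric_refl (R : realType) (X : metricType R) : isometric X X.
Proof. by exists id; split=> //; exists id. Qed.

Lemma isometric_sym (R : realType) (X Y : metricType R) :
  isometric X Y -> isometric Y X.
Proof.
move=> [f [[g fK gK] fd]]; exists g; split; first by exists f.
by move=> x y; rewrite -fd !gK.
Qed.

Lemma isometric_trans (R : realType) (X Y Z : metricType R) :
  isometric X Y -> isometric Y Z -> isometric X Z.
Proof.
move=> [f [bf fd]] [g [bg gd]]; exists (g \o f); split; first exact: bij_comp.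
by move=> x y /=; rewrite gd fd.
Qed.

Lemma isometric_nonempty_compact (R : realType) (X Y : metricType R) :
  isometric X Y -> nonempty_compact X -> nonempty_compact Y.
Proof.
move=> [f [[g fK gK] fd]] [[x _] cX]; split; first by exists (f x).
have -> : [set: Y] = f @` [set: X].
  by apply/seteqP; split=> // y _; exists (g y).
apply: continuous_compact => //; apply: continuous_subspaceT => z.
apply/cvg_ballP => e e0; near=> t.
rewrite ballEmdist /= fd.
by near: t; have := nbhsx_ballx z e e0; rewrite ballEmdist.
Unshelve. all: by end_near. Qed.

Lemma is_GH_space_exists (R : realType) :
  exists M : metricType R -> Prop, is_GH_space M.
Proof.
have exI (X : metricType R) : exists Y, isometric X Y by exists X; exact: isometric_refl.
pose rep (X : metricType R) := proj1_sig (cid (exI X)).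
have repP X : isometric X (rep X) by exact: proj2_sig (cid (exI X)).
have rep_eq X Y : isometric X Y -> rep X = rep Y.
  move=> XY; have e : isometric X = isometric Y.
    apply: functional_extensionality_dep => Z; apply/propext; split.
      by apply: isometric_trans; exact: isometric_sym.
    exact: isometric_trans.
  rewrite /rep; move: (exI X) (exI Y); rewrite e => p q.
  by rewrite (Prop_irrelevance p q).
exists (fun X => nonempty_compact X /\ rep X = X); split.
- by move=> X [].
- move=> X cX; exists (rep X) => //; split.
    exact: isometric_nonempty_compact (repP X) cX.
  by rewrite -(rep_eq _ _ (repP X)).
- by move=> X Y [_ <-] [_ <-] /rep_eq; rewrite -!(rep_eq _ _ (repP _)).
Qed.

(* Main.v *)
Require Import Defs.
From HB Require Import structures.
From mathcomp Require Import all_boot all_order all_algebra.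
From mathcomp Require Import boolp classical_sets reals topology.
From mathcomp Require Import lra.

(* Place two marked points b and a at positions 0 and 2r of a line and the space
   X_k at position 5rk, and let the distance between points of different pieces be
   the distance of the positions: this is S(X), of diameter 5rn. Correspondences
   between the X_k and the Y_k glue to one between S(X) and S(Y), which gives <=.
   Conversely, a correspondence of distortion < r matches b with b, hence X_k with
   Y_k because b sees the pieces at distances that are 2r apart; one of distortion
   >= r is harmless because d_GH(X_k, Y_k) <= r/2. *)

Set Implicit Arguments.
Unset Strict Implicit.
Unset Printing Implicit Defensive.

Import Order.TTheory GRing.Theory Num.Theory.
Local Open Scope classical_set_scope.
Local Open Scope ring_scope.

(** * Boundedness and diameter of compact spaces *)

Section diam.
Variables (R : realType) (X : metricType R).
Hypothesis cX : nonempty_compact X.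

Let has_ubound_mdist :
  has_ubound [set mdist p.1 p.2 | p in [set: X * X]].
Proof.
(* Near-covering form of compactness: the bound [mdist x0 x < n], valid near each point for all
   large [n], holds everywhere for one common [n]. *)
have [[x0 _]] := cX; rewrite compact_near_coveringP => /(_ nat \oo).
move=> /(_ (fun n x => mdist x0 x < n%:R)) [].
  move=> x _; pose B := Num.bound (mdist x0 x + 1).
  exists (ball x 1, [set n | (B <= n)%N]).
    by split; [exact: nbhsx_ballx | exact: nbhs_infty_ge].
  move=> [y n] [/=]; rewrite ballEmdist /= => xy Bn.
  apply: le_lt_trans (metric_triangle x0 x y) _.
  apply: lt_le_trans (_ : B%:R <= _); last by rewrite ler_nat.
  apply: lt_trans (archi_boundP _); first by rewrite ltrD2l.
  by rewrite addr_ge0 ?mdist_ge0.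
move=> N _ /(_ N (leqnn N)) bN.
exists (N%:R + N%:R) => _ [[x y] _ <-] /=.
apply: le_trans (metric_triangle x x0 y) _; rewrite metric_sym.
by apply: lerD; apply: ltW; exact: bN.
Qed.

Lemma mdist_le_diam (x y : X) : mdist x y <= diam X.
Proof. by apply: (ub_le_sup has_ubound_mdist); exists (x, y). Qed.

Lemma diam_le (d : R) : (forall x y : X, mdist x y <= d) -> diam X <= d.
Proof.
move=> dX; apply: ge_sup => [|_ [[x y] _ <-] /=]; last exact: dX.
by have [[x _] _] := cX; exists (mdist x x), (x, x).
Qed.

End diam.

(** * Correspondences and the Gromov-Hausdorff distance *)

Section Gromov_Hausdorff.
Variables (R : realType) (X Y : metricType R).
Hypotheses (cX : nonempty_compact X) (cY : nonempty_compact Y).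

Lemma mdist_le_distortion (C : set (X * Y)) x y x' y' :
  C (x, y) -> C (x', y') ->
  `|mdist x x' - mdist y y'| <= distortion C.
Proof.
move=> Cxy Cxy'; apply: ub_le_sup; last by exists (x, y) => //; exists (x', y').
exists (diam X + diam Y) => _ [[u v] _ [[u' v'] _ <-]] /=.
have := mdist_le_diam cX u u'; have := mdist_le_diam cY v v'.
have := mdist_ge0 u u'; have := mdist_ge0 v v'.
by rewrite ler_norml => *; lra.
Qed.

Lemma GHC_neq0 (C : set (X * Y)) : GHC C -> C !=set0.
Proof. by have [[x _] _] := cX => -[/(_ x)[y]]; exists (x, y). Qed.

Lemma distortion_le (C : set (X * Y)) (d : R) : GHC C ->
  (forall x y x' y', C (x, y) -> C (x', y') ->
    `|mdist x x' - mdist y y'| <= d) ->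
  distortion C <= d.
Proof.
move=> gC dC; apply: ge_sup => [|_ [[x y] Cxy [[x' y'] Cxy' <-]] /=].
  by have [p Cp] := GHC_neq0 gC; eexists; exists p => //; exists p.
exact: dC.
Qed.

Lemma distortion_ge0 (C : set (X * Y)) : GHC C -> 0 <= distortion C.
Proof.
by move=> /GHC_neq0[[x y] Cxy]; apply: le_trans (mdist_le_distortion Cxy Cxy).
Qed.

Lemma dGH_le (C : set (X * Y)) (d : R) : GHC C -> distortion C <= d ->
  dGH X Y <= d / 2.
Proof.
move=> gC Cd; rewrite /dGH mulrC ler_wpM2r ?invr_ge0//.
apply: le_trans Cd; apply: ge_inf; last by exists C.
by exists 0 => _ [D gD <-]; exact: distortion_ge0.
Qed.

(** Keeps the infimum in [dGH] off its default value and yields the crude bound by the diameters. *)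
Lemma GHC_setT : GHC [set: X * Y].
Proof.
have [[x _] _] := cX; have [[y _] _] := cY.
by split=> z; [exists y | exists x].
Qed.

Lemma dGH_ge (d : R) : (forall C : set (X * Y), GHC C -> d <= distortion C / 2) ->
  d <= dGH X Y.
Proof.
move=> dC; rewrite /dGH mulrC -ler_pdivrMr ?invr_gt0// invrK.
apply: lb_le_inf.
  by exists (distortion [set: X * Y]), setT => //; exact: GHC_setT.
by move=> _ [C gC <-]; have := dC _ gC; lra.
Qed.

Lemma dGH_lt (d : R) : dGH X Y < d / 2 ->
  exists2 C : set (X * Y), GHC C & distortion C < d.
Proof.
rewrite /dGH mulrC ltr_pM2r ?invr_gt0// => /inf_lt[].
  by exists (distortion [set: X * Y]), setT => //; exact: GHC_setT.
by move=> _ [C gC <-]; exists C.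
Qed.

Lemma dGH_ge0 : 0 <= dGH X Y.
Proof.
by apply: dGH_ge => C /distortion_ge0 C0; rewrite divr_ge0.
Qed.

Lemma dGH_le_diam (d : R) : diam X <= d -> diam Y <= d -> dGH X Y <= d / 2.
Proof.
move=> dX dY; apply: (dGH_le GHC_setT); apply: (distortion_le GHC_setT).
move=> x y x' y' _ _.
have := le_trans (mdist_le_diam cX x x') dX.
have := le_trans (mdist_le_diam cY y y') dY.
have := mdist_ge0 x x'; have := mdist_ge0 y y'.
by rewrite ler_norml => *; lra.
Qed.

End Gromov_Hausdorff.

(** * Invariance under isometry *)

Section isometric_invariance.
Variable R : realType.

Let diam_set_sub (X X' : metricType R) : isometric X X' ->
  [set mdist p.1 p.2 | p in [set: X * X]] `<=`
  [set mdist p.1 p.2 | p in [set: X' * X']].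
Proof.
by move=> [f [_ fd]] _ [[x y] _ <-]; exists (f x, f y) => //=; rewrite fd.
Qed.

Lemma isometric_diam (X X' : metricType R) : isometric X X' -> diam X = diam X'.
Proof.
move=> i; congr sup; apply/seteqP.
by split; apply: diam_set_sub => //; exact: isometric_sym.
Qed.

Let dGH_set_sub (X X' Y Y' : metricType R) :
  isometric X X' -> isometric Y Y' ->
  [set distortion C | C in @GHC X Y] `<=` [set distortion C | C in @GHC X' Y'].
Proof.
move=> [f [[f' fK f'K] fd]] [g [[g' gK g'K] gd]] _ [C [C1 C2] <-].
exists [set p | C (f' p.1, g' p.2)].
  split=> [x|y] /=.
    by have [y Cy] := C1 (f' x); exists (g y); rewrite gK.
  by have [x Cx] := C2 (g' y); exists (f x); rewrite fK.
congr sup; apply/seteqP; split=> _ [[x y] Cxy [[x' y'] Cxy' <-]] /=.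
  exists (f' x, g' y) => //; exists (f' x', g' y') => //=.
  by rewrite -fd -gd !f'K !g'K.
exists (f x, g y) => /=; first by rewrite fK gK.
by exists (f x', g y') => /=; rewrite ?fK ?gK// fd gd.
Qed.

Lemma isometric_dGH (X X' Y Y' : metricType R) :
  isometric X X' -> isometric Y Y' -> dGH X Y = dGH X' Y'.
Proof.
move=> i j; congr (_ * inf _); apply/seteqP.
by split; apply: dGH_set_sub => //; exact: isometric_sym.
Qed.

End isometric_invariance.

(** * One-point spaces *)

(* [R] is a phantom argument that determines the scalars of the metric instance. *)
Definition one_point (R : realType) : Type := unit.

Section one_point_metric.
Variable R : realType.

Let d (x y : one_point R) : R := 0.

Let d_xx x : d x x = 0. Proof. by []. Qed.

Let d_pos x y : d x y = 0 -> x = y. Proof. by case: x; case: y. Qed.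

Let d_sym x y : d x y = d y x. Proof. by []. Qed.

Let d_tri y x z : d x z <= d x y + d y z. Proof. by rewrite addr0. Qed.

HB.instance Definition _ := Choice.copy (one_point R) unit.
HB.instance Definition _ := isMetric.Build R (one_point R) d_xx d_pos d_sym d_tri.

Lemma nonempty_compact_one_point : nonempty_compact (one_point R).
Proof.
split; first by exists tt.
have -> : [set: one_point R] = [set tt] by apply/seteqP; split=> [[]|].
exact: compact_set1.
Qed.

Lemma mdist_one_point (x y : one_point R) : mdist x y = 0.
Proof. by []. Qed.

End one_point_metric.

(** * Gluing metric spaces along a line *)

(* The factor 2 is what the triangle inequality needs for a path that leaves
   the i-th piece, visits the j-th one and comes back. *)
Definition spaced (R : realType) (I : Type) (P : I -> metricType R) (t : I -> R) :=
  injective t /\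
  forall i j, i <> j -> forall x y : P i, mdist x y <= 2 * `|t i - t j|.

(** The proof [s] is a parameter of the type so that the metric instance, whose axioms rest on it,
    can be inferred from the type. *)
Definition line_sum (R : realType) (I : choiceType) (P : I -> metricType R)
  (t : I -> R) (s : spaced P t) : Type := {i : I & P i}.

Section line_sum_metric.
Variables (R : realType) (I : choiceType) (P : I -> metricType R) (t : I -> R).
Variable s : spaced P t.
Local Notation T := (line_sum s).

HB.instance Definition _ := Choice.copy T {i : I & P i}.

Let d (u v : T) : R := if tag u == tag v then mdist (tagged u) (tagged_as u v)
  else `|t (tag u) - t (tag v)|.

Let d_same i (x y : P i) : d (Tagged P x) (Tagged P y) = mdist x y.
Proof. by rewrite /d /= eqxx tagged_asE. Qed.

Let d_diff (u v : T) : tag u <> tag v -> d u v = `|t (tag u) - t (tag v)|.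
Proof. by rewrite /d => /eqP/negbTE ->. Qed.

Let d_xx u : d u u = 0.
Proof. by case: u => i x; rewrite (d_same x x) mdistxx. Qed.

Let d_pos u v : d u v = 0 -> u = v.
Proof.
have [|ne] := eqVneq (tag u) (tag v).
  (* Eliminating the equality of indices puts both points in the same fibre. *)
  case: u v => i x [j y] /= e; case: _ / e y => y.
  by rewrite (d_same x y) => /mdist_positivity ->.
rewrite d_diff; last exact/eqP.
move=> /normr0_eq0/subr0_eq/(proj1 s)/eqP e.
by rewrite e in ne.
Qed.

Let d_sym u v : d u v = d v u.
Proof.
have [|ne] := eqVneq (tag u) (tag v).
  case: u v => i x [j y] /= e; case: _ / e y => y.
  by rewrite (d_same x y) (d_same y x) metric_sym.
by rewrite !d_diff 1?distrC//; apply/eqP => //; rewrite eq_sym.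
Qed.

Let d_tri v u w : d u w <= d u v + d v w.
Proof.
have [|/eqP uw] := eqVneq (tag u) (tag w).
  case: u w => i x [j y] /= e; case: _ / e y => y.
  have [|/eqP uv] := eqVneq i (tag v).
    case: v => k z /= e; case: _ / e z => z.
    rewrite (d_same x y) (d_same x z) (d_same z y).
    exact: metric_triangle.
  (* The detour through [v] costs the distance between the two positions twice. *)
  rewrite (d_same x y) d_diff// d_diff /=; last exact/nesym.
  rewrite [X in _ + X]distrC -mulr2n -mulr_natl.
  exact: (proj2 s).
(* If [v] shares the piece of one endpoint, the other leg alone has the full length; otherwise this
   is the triangle inequality of the line. *)
rewrite (d_diff uw); have [|/eqP uv] := eqVneq (tag u) (tag v).
  case: u v uw => i x [j y] /= uw e; case: _ / e y => y.
  by rewrite (d_same x y) (@d_diff (Tagged P y))// lerDr mdist_ge0.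
have [|/eqP vw] := eqVneq (tag v) (tag w).
  case: v w uw uv => i x [j y] /= uw uv e.
  case: _ / e y uw => y uw.
  by rewrite (d_same x y) d_diff// lerDl mdist_ge0.
rewrite !d_diff//; exact: ler_distD.
Qed.

HB.instance Definition _ := isMetric.Build R T d_xx d_pos d_sym d_tri.

Definition in_piece i (x : P i) : T := Tagged P x.

Lemma mdist_in_piece i (x y : P i) :
  mdist (in_piece x) (in_piece y) = mdist x y.
Proof. exact: d_same. Qed.

Lemma mdist_pieces (u v : T) : tag u <> tag v ->
  mdist u v = `|t (tag u) - t (tag v)|.
Proof. exact: d_diff. Qed.

End line_sum_metric.

(** Pieces embed isometrically, hence continuously, so the sum is a finite union of compact
    images. *)
Lemma line_sum_nonempty_compact (R : realType) (I : finType)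
    (P : I -> metricType R) (t : I -> R) (s : spaced P t) (i0 : I) :
  (forall i, nonempty_compact (P i)) -> nonempty_compact (line_sum s).
Proof.
move=> cP; split; first by have [[x _] _] := cP i0; exists (in_piece s x).
have -> : [set: line_sum s] =
    \big[setU/set0]_(i : I) (@in_piece _ _ _ _ s i @` setT).
  apply/seteqP; split=> // -[i x] _.
  by rewrite -bigcup_seq; exists i => /=; [rewrite mem_index_enum | exists x].
apply: bigsetU_compact => i _; apply: continuous_compact; last by have [] := cP i.
apply: continuous_subspaceT => z; apply/cvg_ballP => e e0; near=> x.
rewrite ballEmdist /= mdist_in_piece.
by near: x; have := nbhsx_ballx z e e0; rewrite ballEmdist.
Unshelve. all: by end_near. Qed.

(** The union of the given correspondences works: both sums use the same positions, so pairs from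
    different pieces contribute no distortion. *)
Lemma line_sum_dGH_le (R : realType) (I : finType) (P Q : I -> metricType R)
    (t : I -> R) (s : spaced P t) (s' : spaced Q t) (i0 : I) (d : R) :
  (forall i, nonempty_compact (P i)) -> (forall i, nonempty_compact (Q i)) ->
  0 <= d ->
  (forall i, exists2 C : set (P i * Q i), GHC C & distortion C <= d) ->
  dGH (line_sum s) (line_sum s') <= d / 2.
Proof.
move=> cP cQ d0 exC.
have {exC}[C gC Cd] : exists2 C : forall i, set (P i * Q i),
    forall i, GHC (C i) & forall i, distortion (C i) <= d.
  have exC' i : exists C : set (P i * Q i), GHC C /\ distortion C <= d.
    by have [C] := exC i; exists C.
  by exists (fun i => sval (cid (exC' i))) => i; case: cid => /= ? [].
pose U := [set p : line_sum s * line_sum s' | exists i (x : P i) (y : Q i),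
  p = (in_piece s x, in_piece s' y) /\ C i (x, y)].
have gU : GHC U.
  split=> [[i x]|[i y]].
    by have [y Cxy] := (gC i).1 x; exists (in_piece s' y), i, x, y.
  by have [x Cxy] := (gC i).2 y; exists (in_piece s x), i, x, y.
have cS : nonempty_compact (line_sum s) by exact: line_sum_nonempty_compact.
have cS' : nonempty_compact (line_sum s') by exact: line_sum_nonempty_compact.
apply: (dGH_le cS cS' gU); apply: (distortion_le cS gU).
move=> _ _ _ _ [i [x [y [[-> ->] Cxy]]]] [j [x' [y' [[-> ->] Cxy']]]].
have [ij|/eqP ij] := eqVneq i j.
  case: _ / ij x' y' Cxy' => x' y' Cxy'.
  rewrite !mdist_in_piece; apply: le_trans (Cd i).
  exact: mdist_le_distortion.
by rewrite !mdist_pieces//= subrr normr0.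
Qed.

(** * The pieces, their positions and the diameter of their sum *)

Section pieces.
Variables (R : realType) (n : nat) (r : R).
Hypothesis r0 : 0 < r.

Definition piece (X : 'I_n -> metricType R) (i : 'I_n + bool) : metricType R :=
  match i with inl k => X k | inr _ => one_point R end.

(** [inr false] is the marked point b and [inr true] is a. Ordinals start at 0, hence the successor:
    the spaces lie at 5r, ..., 5rn. *)
Definition position (i : 'I_n + bool) : R :=
  match i with inl k => 5 * r * k.+1%:R | inr b => if b then 2 * r else 0 end.

Let le_position_inl k : 5 * r <= position (inl k).
Proof. by rewrite /= ler_peMr ?ler1n// mulr_ge0// ltW. Qed.

Let position_inl_gap (k l : 'I_n) : (k < l)%N ->
  position (inl k) + 5 * r <= position (inl l).
Proof.
move=> kl; rewrite /= -[X in _ + X]mulr1 -mulrDr ler_wpM2l ?mulr_ge0 ?(ltW r0)//.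
by rewrite natr1 ler_nat ltnS.
Qed.

(** Apart from the gap 2r between the marked points, the smallest gap is 3r, from 2r to the first
    space at 5r. *)
Lemma position_close i j : i <> j -> `|position i - position j| < 3 * r ->
  exists b, i = inr b /\ j = inr (~~ b).
Proof.
have r0' := r0; have posk := le_position_inl.
case: i j => [k|b] [l|c] ij.
- rewrite ltr_norml => /andP[h1 h2]; exfalso.
  have [kl|lk|/val_inj kl] := ltngtP k l.
  + by have := position_inl_gap kl; lra.
  + by have := position_inl_gap lk; lra.
  + by apply: ij; rewrite kl.
- rewrite ltr_norml => /andP[h1 h2]; exfalso.
  by have := posk k; case: c {ij} h1 h2 => /=; lra.
- rewrite ltr_norml => /andP[h1 h2]; exfalso.
  by have := posk l; case: b {ij} h1 h2 => /=; lra.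
- by move=> _; exists b; case: b c ij => -[].
Qed.

Lemma position_gap i j : i <> j -> 2 * r <= `|position i - position j|.
Proof.
move=> ij; rewrite leNgt; apply/negP => lt2.
have [|b [ei ej]] := position_close ij.
  by apply: lt_trans lt2 _; rewrite ltr_pM2r// ltr_nat.
move: lt2; rewrite ei ej ltr_norml; have := r0.
by case: b {ei ej} => /= ? /andP[]; lra.
Qed.

Lemma position_bound i : (0 < n)%N -> 0 <= position i <= 5 * r * n%:R.
Proof.
move=> n0; case: i => [k|b].
  rewrite /= mulr_ge0 ?mulr_ge0 ?(ltW r0)//=.
  by rewrite ler_wpM2l ?mulr_ge0 ?(ltW r0)// ler_nat.
have h : 5 * r <= 5 * r * n%:R by rewrite ler_peMr ?ler1n// mulr_ge0// ltW.
by have := r0; case: b => /= ?; apply/andP; split; lra.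
Qed.

Lemma piece_nonempty_compact (X : 'I_n -> metricType R) :
  (forall k, nonempty_compact (X k)) ->
  forall i, nonempty_compact (piece X i).
Proof. by move=> cX [k|b]; [exact: cX | exact: nonempty_compact_one_point]. Qed.

Lemma mdist_piece_le (X : 'I_n -> metricType R) :
  (forall k, nonempty_compact (X k)) -> (forall k, diam (X k) <= r) ->
  forall i (x y : piece X i), mdist x y <= r.
Proof.
move=> cX dX [k|b] x y; first exact: le_trans (mdist_le_diam (cX k) x y) (dX k).
by rewrite [leLHS](mdist_one_point x y) ltW.
Qed.

Lemma piece_spaced (X : 'I_n -> metricType R) :
  (forall k, nonempty_compact (X k)) -> (forall k, diam (X k) <= r) ->
  spaced (piece X) position.
Proof.
move=> cX dX; split=> [i j ij|i j ij x y].
  apply: contrapT => /position_gap; rewrite ij subrr normr0 leNgt.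
  by rewrite mulr_gt0.
apply: le_trans (mdist_piece_le cX dX x y) _.
by have := position_gap ij; have := r0; lra.
Qed.

Section line_sum_piece.
Variables (X : 'I_n -> metricType R) (s : spaced (piece X) position).
Hypotheses (cX : forall k, nonempty_compact (X k)).
Hypotheses (dX : forall k, diam (X k) <= r).
Local Notation T := (line_sum s).

Definition marked (b : bool) : T := @in_piece _ _ _ _ s (inr b) tt.

Lemma marked_uniq (u : T) b : tag u = inr b -> u = marked b.
Proof. by case: u => -[k|c] x //= [<-]; case: x. Qed.

(** The formula survives when [u] lies in the piece of the marked point, because that piece is a
    single point. *)
Lemma mdist_marked (u : T) b :
  mdist u (marked b) = `|position (tag u) - position (inr b)|.
Proof.
have [ub|/eqP ub] := eqVneq (tag u) (inr b); last exact: mdist_pieces.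
by rewrite (marked_uniq ub) subrr normr0 mdistxx.
Qed.

Lemma mdist_same_piece (u v : T) : tag u = tag v -> mdist u v <= r.
Proof.
case: u v => i x [j y] /= e; case: _ / e y => y.
by rewrite [leLHS](mdist_in_piece s x y); exact: mdist_piece_le.
Qed.

Lemma nonempty_compact_pieces : nonempty_compact T.
Proof.
exact: line_sum_nonempty_compact (inr true) (piece_nonempty_compact cX).
Qed.

Lemma diam_pieces : (0 < n)%N -> diam T = 5 * r * n%:R.
Proof.
move=> n0; have cT := nonempty_compact_pieces.
apply/le_anti/andP; split.
  apply: (diam_le cT) => u v.
  have [uv|/eqP uv] := eqVneq (tag u) (tag v).
    apply: le_trans (mdist_same_piece uv) _.
    apply: le_trans (_ : 5 * r <= _); first by have := r0; lra.
    by rewrite ler_peMr ?ler1n// mulr_ge0// ltW.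
  rewrite mdist_pieces// ler_norml.
  have /andP[h1 h2] := position_bound (tag u) n0.
  have /andP[h3 h4] := position_bound (tag v) n0.
  by apply/andP; split; lra.
(* The diameter is attained between the last space, at 5rn, and the marked point at 0. *)
have kn : (n.-1 < n)%N by rewrite prednK.
have [[x _] _] := cX (Ordinal kn).
have := mdist_le_diam cT (@in_piece _ _ _ _ s (inl (Ordinal kn)) x) (marked false).
rewrite mdist_marked /= prednK// subr0 ger0_norm//.
by rewrite !mulr_ge0// ltW.
Qed.

End line_sum_piece.

(** * The distance between two glued spaces *)

Section dGH_pieces.
Variables (X Y : 'I_n -> metricType R).
Variables (s : spaced (piece X) position) (s' : spaced (piece Y) position).
Hypotheses (cX : forall k, nonempty_compact (X k)).
Hypotheses (cY : forall k, nonempty_compact (Y k)).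
Hypotheses (dX : forall k, diam (X k) <= r).
Hypotheses (dY : forall k, diam (Y k) <= r).
Hypothesis n0 : (0 < n)%N.

Let cS : nonempty_compact (line_sum s).
Proof. exact: nonempty_compact_pieces. Qed.

Let cS' : nonempty_compact (line_sum s').
Proof. exact: nonempty_compact_pieces. Qed.

(* The marked points are the only ones at distance 2r up to an error less than
   r, so C preserves the pair of them; they cannot be swapped because the
   first space lies at distance 5r from one and 3r from the other. *)
Let marked_corr (C : set (line_sum s * line_sum s')) :
  GHC C -> distortion C < r -> C (marked s false, marked s' false).
Proof.
move=> [C1 C2] Cr.
have C_lt u u' v v' : C (u, u') -> C (v, v') ->
    `|mdist u v - mdist u' v'| < r.
  by move=> h h'; apply: le_lt_trans (mdist_le_distortion cS cS' h h') Cr.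
have [a Ca] := C1 (marked s true); have [b Cb] := C1 (marked s false).
have := C_lt _ _ _ _ Ca Cb; rewrite mdist_marked /= subr0 ltr_norml.
have r0' := r0; rewrite (ger0_norm (_ : 0 <= 2 * r)); last by lra.
move=> /andP[ab1 ab2].
(* The distance of [a] and [b] differs from 2r by less than r, so it exceeds r, the bound within one
   piece. *)
have ab : tag a <> tag b.
  by move=> /(mdist_same_piece cY dY); lra.
rewrite mdist_pieces// in ab1 ab2.
have [|c [ta tb]] := position_close ab; first by lra.
case: c ta tb => /marked_uniq aE /marked_uniq bE; first by rewrite -bE.
(* Swapped case: [a] sits at 0 and [b] at 2r. A point of the first space is used to tell them
   apart. *)
have [[x _] _] := cX (Ordinal n0).
have [y Cxy] := C1 (@in_piece _ _ _ _ s (inl (Ordinal n0)) x).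
have := C_lt _ _ _ _ Cxy Ca; have := C_lt _ _ _ _ Cxy Cb.
rewrite aE bE !mdist_marked /= subr0 mulr1 (ger0_norm (_ : 0 <= 5 * r)); last by lra.
rewrite (ger0_norm (_ : 0 <= 5 * r - 2 * r)); last by lra.
rewrite subr0 !ltr_norml => /andP[h1 h2] /andP[h3 h4].
(* The partner [y] must be between 2r and 4r away from position 0, which excludes the spaces, and
   between 4r and 6r away from position 2r, which excludes the marked points. *)
case: (tag y) h1 h2 h3 h4 => [k|[]] /=.
- have := le_position_inl k => /= ? _ _ h3 h4.
  by rewrite ger0_norm in h3; lra.
- by rewrite subrr normr0; lra.
- by rewrite normr0; lra.
Qed.

(** The distance to the marked point at 0 is the position itself, so matched points have positions
    less than r apart, whereas distinct positions are at least 2r apart. *)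
Let corr_same_piece (C : set (line_sum s * line_sum s')) u v :
  GHC C -> distortion C < r -> C (u, v) -> tag u = tag v.
Proof.
move=> gC Cr Cuv; apply: contrapT => /position_gap; apply/negP; rewrite -ltNge.
have := mdist_le_distortion cS cS' Cuv (marked_corr gC Cr).
have nn i : 0 <= position i by case/andP: (position_bound i n0).
rewrite !mdist_marked !subr0 (ger0_norm (nn (tag u))) (ger0_norm (nn (tag v))) => h.
by apply: le_lt_trans h _; have := r0; lra.
Qed.

Let dGH_le_corr (C : set (line_sum s * line_sum s')) k : GHC C ->
  dGH (X k) (Y k) <= distortion C / 2.
Proof.
move=> gC; have [rC|Cr] := leP r (distortion C).
  apply: le_trans (dGH_le_diam (cX k) (cY k) (dX k) (dY k)) _.
  by rewrite ler_pM2r ?invr_gt0.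
pose iX (x : X k) := @in_piece _ _ _ _ s (inl k) x.
pose iY (y : Y k) := @in_piece _ _ _ _ s' (inl k) y.
pose D := [set p : X k * Y k | C (iX p.1, iY p.2)].
(* Totality on both sides survives the restriction because partners lie in the same piece. *)
have gD : GHC D.
  split=> [x|y].
    have [v Cxv] := gC.1 (iX x); have := corr_same_piece gC Cr Cxv.
    case: v Cxv => j y Cxy /= e; case: _ / e y Cxy => y Cxy.
    by exists y.
  have [u Cuy] := gC.2 (iY y); have := corr_same_piece gC Cr Cuy.
  case: u Cuy => j x Cxy /= e; case: _ / (esym e) x Cxy => x Cxy.
  by exists x.
apply: (dGH_le (cX k) (cY k) gD); apply: (distortion_le (cX k) gD).
move=> x y x' y' Dxy Dxy'.
rewrite -(@mdist_in_piece _ _ _ _ s (inl k)) -(@mdist_in_piece _ _ _ _ s' (inl k)).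
exact: (mdist_le_distortion cS cS' Dxy Dxy').
Qed.

Lemma dGH_pieces :
  dGH (line_sum s) (line_sum s') = \big[Num.max/0]_(k < n) dGH (X k) (Y k).
Proof.
apply/le_anti/andP; split; last first.
  apply: bigmax_le => [|k _]; first exact: dGH_ge0.
  by apply: (dGH_ge cS cS') => C; exact: dGH_le_corr.
set m := \big[_/_]_(_ < _) _.
have m0 : 0 <= m by exact: bigmax_ge_id.
(* The slack [e] replaces attainment of the infimum: each pair of spaces has a correspondence of
   distortion below 2(m + e). *)
apply/ler_addgt0Pr => e e0.
have -> : m + e = (2 * (m + e)) / 2 by lra.
apply: (line_sum_dGH_le s s' (inr true)).
- exact: piece_nonempty_compact.
- exact: piece_nonempty_compact.
- by lra.
move=> [k|b].
  have [|C gC Cd] := @dGH_lt _ _ _ (cX k) (cY k) (2 * (m + e)).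
    have := le_bigmax 0 (fun k => dGH (X k) (Y k)) k; rewrite -/m; lra.
  by exists C => //; exact: ltW.
have c1 := nonempty_compact_one_point R.
exists setT; first exact: GHC_setT.
apply: (distortion_le c1); first exact: GHC_setT.
by move=> x y x' y' _ _; rewrite !mdist_one_point subrr normr0; lra.
Qed.

End dGH_pieces.

End pieces.

Theorem theorem1p3 (R : realType) (M : metricType R -> Prop)
    (hM : is_GH_space M) (r : R) (hr : 0 < r) (n : nat) (hn : (0 < n)%N) :
  exists S : ('I_n -> GH_le M r) -> GH_sphere M (5 * r * n%:R),
    forall X Y : 'I_n -> GH_le M r,
      dGH (proj1_sig (S X)) (proj1_sig (S Y)) =
      \big[Num.max/0]_(k < n) dGH (proj1_sig (X k)) (proj1_sig (Y k)).
Proof.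
have [M_compact M_repr _] := hM.
have cX (X : 'I_n -> GH_le M r) k : nonempty_compact (proj1_sig (X k)).
  by apply: M_compact; case: (X k) => /= Z [].
have dX (X : 'I_n -> GH_le M r) k : diam (proj1_sig (X k)) <= r.
  by case: (X k) => /= Z [].
pose T X : metricType R := line_sum (piece_spaced hr (cX X) (dX X)).
(* The glued space itself may lie outside [M], so its representative is taken; diameter and
   distances carry over by isometry. *)
have exS X : exists Z : metricType R, M Z /\ isometric (T X) Z.
  have [|Z MZ TZ] := M_repr (T X); last by exists Z.
  exact: nonempty_compact_pieces (cX X).
have S_diam X : diam (proj1_sig (cid (exS X))) = 5 * r * n%:R.
  case: cid => /= Z [_ /isometric_diam <-].
  exact: diam_pieces.
exists (fun X => exist _ (proj1_sig (cid (exS X)))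
  (conj (proj1 (proj2_sig (cid (exS X)))) (S_diam X))) => X Y /=.
have [_ TX] := proj2_sig (cid (exS X)); have [_ TY] := proj2_sig (cid (exS Y)).
rewrite -(isometric_dGH TX TY).
exact: dGH_pieces.
Qed.
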